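(* Let $X$ be a real Banach space which is a conjugate (dual) space, i.e. $X=W^*$ for some Banach space $W$. If $X$ is universally left-stable, then $X$ is an injective space.
   Context: All Banach spaces are real. For $\varepsilon\ge0$, a map $f:X\to Y$ between Banach spaces (not assumed linear, continuous or surjective) is called a standard $\varepsilon$-isometry if $f(0)=0$ and $\big|\|f(x)-f(y)\|-\|x-y\|\big|\le\varepsilon$ for all $x,y\in X$. For such $f$, $L(f)=\overline{\mathrm{span}}\,f(X)$ denotes the closed linear span of $f(X)$ in $Y$. A Banach space $X$ is universally left-stable (a universal left-stability space) if for every Banach space $Y$ there is a finite constant $\gamma>0$ such that for every $\varepsilon\ge0$ and every standard $\varepsilon$-isometry $f:X\to Y$ there exists a bounded linear operator $T:L(f)\to X$ with $\|Tf(x)-x\|\le\gamma\varepsilon$ for all $x\in X$. A Banach space $X$ is injective if every bounded linear operator from a closed subspace of a Banach space into $X$ can be extended to a bounded linear operator on the whole space with values in $X$. *)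

(* Defs.v *)
From mathcomp Require Import all_boot all_order all_algebra.
From mathcomp Require Import all_classical all_reals all_analysis.

Set Implicit Arguments.
Unset Strict Implicit.
Unset Printing Implicit Defensive.

Import Order.TTheory GRing.Theory Num.Theory.
Import numFieldNormedType.Exports.

Local Open Scope classical_set_scope.
Local Open Scope ring_scope.

Section Subspaces.
Context {R : realType} {Y : normedModType R}.

Definition linear_subspace (M : set Y) : Prop :=
  M 0 /\ forall (a : R) (u v : Y), M u -> M v -> M (a *: u + v).

Definition linear_span (S : set Y) : set Y :=
  [set y | exists (n : nat) (a : 'I_n -> R) (s : 'I_n -> Y),
     (forall i, S (s i)) /\ y = \sum_(i < n) a i *: s i].

Definition closed_span (S : set Y) : set Y := closure (linear_span S).

End Subspaces.

(* An operator defined on a subspace M of Y is encoded by a total function on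
   Y; only its values on M matter. *)
Definition bounded_linear_on {R : realType} {Y X : normedModType R}
    (M : set Y) (T : Y -> X) : Prop :=
  (forall (a : R) (u v : Y), M u -> M v -> T (a *: u + v) = a *: T u + T v)
  /\ (exists C : R, forall u, M u -> `|T u| <= C * `|u|).

Definition dual_norm {R : realType} {W : normedModType R} (phi : W -> R^o) : R :=
  sup [set `|phi w| | w in [set w | `|w| <= 1]].

(* X = W^*, up to a linear isometry J of X onto the space of bounded linear
   functionals on W. *)
Definition is_dual_of {R : realType} (X W : normedModType R) : Prop :=
  exists J : X -> W -> R^o,
    [/\ forall x, bounded_linear_on setT (J x),
        forall (a : R) (x y : X) (w : W), J (a *: x + y) w = a * J x w + J y w,
        forall x, dual_norm (J x) = `|x|
      & forall phi : W -> R^o, bounded_linear_on setT phi ->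
          exists x, forall w, J x w = phi w].

Definition standard_eps_isometry {R : realType} {X Y : normedModType R}
    (e : R) (f : X -> Y) : Prop :=
  f 0 = 0 /\ forall x y, `| `|f x - f y| - `|x - y| | <= e.

Definition universally_left_stable {R : realType}
    (X : completeNormedModType R) : Prop :=
  forall Y : completeNormedModType R, exists2 gamma : R, 0 < gamma &
    forall (e : R) (f : X -> Y), 0 <= e -> standard_eps_isometry e f ->
      exists2 T : Y -> X, bounded_linear_on (closed_span (range f)) T &
        forall x, `|T (f x) - x| <= gamma * e.

Definition injective_space {R : realType}
    (X : completeNormedModType R) : Prop :=
  forall (Z : completeNormedModType R) (M : set Z) (T : Z -> X),
    linear_subspace M -> closed M -> bounded_linear_on M T ->
    exists2 S : Z -> X, bounded_linear_on setT S & forall z, M z -> S z = T z.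

(* Main.v *)
From HB Require Import structures.
Require Import Defs.
From mathcomp Require Import all_boot all_order all_algebra.
From mathcomp Require Import all_classical all_reals all_analysis.
From mathcomp Require Import ring.

Set Implicit Arguments.
Unset Strict Implicit.
Unset Printing Implicit Defensive.

Import Order.TTheory GRing.Theory Num.Theory.
Import numFieldNormedType.Exports.

Local Open Scope classical_set_scope.
Local Open Scope ring_scope.

(** Let i : X -> Y be a linear isometry into a Banach space and let y_1, ..., y_n
    be nonzero vectors of Y.  Bump i at n nonzero points x_1, ..., x_n of X: put
    f x_k = i x_k + y_k / |y_k| and f x = i x elsewhere.  This f is a standard
    2-isometry, and left stability gives a linear T on the closed span of f(X)
    with |T (f x) - x| <= 2 gamma for all x.  Every nonzero x has arbitrarily
    large multiples m x off the finite set of bumps, where f (m x) = m (i x), so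
    dividing by m shows T (i x) = x exactly.  The estimate at the bump x_k
    then says |T y_k| <= 2 gamma |y_k|.  So near any finite subset of Y there is
    a linear projection onto X whose bound 2 gamma depends on Y alone
    ([stable_local_projections]): gamma is chosen before f.

    When X is the dual of W, bounded subsets of X are weak* relatively compact,
    so these local projections, indexed by the finite subsets of Y, converge
    weak* along an ultrafilter to a bounded linear P : Y -> X with P (i x) = x
    ([dual_projection_of_local]).

    Take for Y the space of bounded functions on W and for i the restriction of
    functionals to the unit ball of W.  An operator T from a subspace M of Z to X
    gives i T : M -> Y, which extends to Z because each of its coordinates does,
    with the same bound, by the Hahn-Banach theorem
    ([dual_embedding_extension]).  Composing the extension with P gives an
    extension of T with values in X. *)

(** * The Hahn-Banach theorem for a multiple of a norm *)

Section HahnBanach.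
Context {R : realType} {Z : normedModType R} (C : R).

(** Partial linear functionals are handled through their graphs, so that
    Zorn's lemma applies to inclusion of sets and no domain has to be carried
    around.  That such a set is single-valued follows from the bound
    ([dominated_graph_fun]). *)
Definition dominated_graph (B : set (Z * R)) : Prop :=
  [/\ B (0, 0),
      forall a p q, B p -> B q -> B (a *: p.1 + q.1, a * p.2 + q.2)
    & forall p, B p -> p.2 <= C * `|p.1|].

(** The difference of two values at the same point is a value at 0, which the
    bound makes nonpositive; exchange the two values. *)
Lemma dominated_graph_fun (B : set (Z * R)) (z : Z) (r s : R) :
  dominated_graph B -> B (z, r) -> B (z, s) -> r = s.
Proof.
move=> [_ Blin Ble].
suff le x y : B (z, x) -> B (z, y) -> y <= x.
  by move=> Br Bs; apply/eqP; rewrite eq_le !le.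
move=> Bx By; have /Ble/= := Blin (- 1) _ _ Bx By.
by rewrite scaleN1r addNr normr0 mulr0 mulN1r addrC subr_le0.
Qed.

(** A value c at z0 preserves the bound as soon as
    p.2 - C |p.1 - z0| <= c <= C |p.1 + z0| - p.2 for all p in B, since other
    multiples of z0 reduce to these two by homogeneity.  The triangle inequality
    puts every left-hand side below every right-hand side, so the supremum of the
    former will do. *)
Lemma dominated_graph_step (B : set (Z * R)) (z0 : Z) :
  0 <= C -> dominated_graph B ->
  exists2 B', dominated_graph B' & B `<=` B' /\ exists r, B' (z0, r).
Proof.
move=> C0 [B0 Blin Ble].
have BZ a p : B p -> B (a *: p.1, a * p.2).
  by move=> Bp; have := Blin a _ _ Bp B0; rewrite /= !addr0.
pose S := [set p.2 - C * `|p.1 - z0| | p in B].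
have Sub p : B p -> ubound S (C * `|p.1 + z0| - p.2).
  move=> Bp _ [q Bq <-]; rewrite lerBrDr addrAC lerBlDr.
  have := Ble _ (Blin 1 _ _ Bp Bq); rewrite /= scale1r mul1r [q.2 + _]addrC.
  move/le_trans; apply; rewrite -mulrDr ler_wpM2l//.
  rewrite (_ : p.1 + q.1 = (p.1 + z0) + (q.1 - z0)) ?ler_normD//.
  by rewrite addrACA subrr addr0.
have S0 : S !=set0 by exists (0 - C * `|0 - z0|), (0, 0).
pose c := sup S.
have cge p : B p -> p.2 - C * `|p.1 - z0| <= c.
  move=> Bp; apply: ub_le_sup.
    by exists (C * `|0 + z0| - 0); exact: (Sub _ B0).
  by exists p.
have cle p : B p -> c <= C * `|p.1 + z0| - p.2.
  by move=> Bp; apply: ge_sup => //; exact: Sub.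
exists [set q | exists2 p, B p & exists t, q = (p.1 + t *: z0, p.2 + t * c)];
  last first.
  split.
    move=> [z r] Bzr; exists (z, r) => //.
    by exists 0; rewrite /= scale0r mul0r !addr0.
  by exists c, (0, 0) => //; exists 1; rewrite /= scale1r mul1r !add0r.
split.
- by exists (0, 0) => //; exists 0; rewrite /= scale0r mul0r !addr0.
- move=> a _ _ [p Bp [t ->]] [q Bq [s ->]] /=.
  exists (a *: p.1 + q.1, a * p.2 + q.2); first exact: Blin.
  exists (a * t + s) => /=; congr (_, _); last by ring.
  by rewrite scalerDr scalerDl scalerA addrACA.
- move=> _ [p Bp [t ->]] /=.
  have [t0|t0|->] := ltgtP t 0; last by rewrite scale0r mul0r !addr0; exact: Ble.
  + have := cge _ (BZ (- t)^-1 _ Bp); rewrite /= lerBlDr -subr_le0.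
    have s0 : 0 < - t by rewrite oppr_gt0.
    rewrite -(pmulr_rle0 _ s0) opprD !mulrDr !mulrN mulVKf ?gt_eqF// addrA.
    rewrite mulrCA -[X in _ * (X * _)](gtr0_norm s0) -normrZ scalerBr.
    rewrite scalerA mulfV ?gt_eqF// scale1r scaleNr opprK mulNr opprK.
    by rewrite subr_le0.
  + have := cle _ (BZ t^-1 _ Bp); rewrite /= lerBrDr -subr_le0.
    rewrite -(pmulr_rle0 _ t0) !mulrDr mulVKf ?gt_eqF// mulrN.
    rewrite mulrCA -[X in _ * (X * _)](gtr0_norm t0) -normrZ scalerDr.
    rewrite scalerA mulfV ?gt_eqF// scale1r subr_le0.
    by rewrite [t * c + _]addrC.
Qed.

Lemma dominated_graph_max (B : set (Z * R)) : dominated_graph B ->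
  exists2 A, dominated_graph A & B `<=` A /\
    forall A', dominated_graph A' -> A `<=` A' -> A' `<=` A.
Proof.
move=> Bgraph.
(* Zorn's lemma also tests the empty chain, whose union is empty: the sets
   ranged over are what is added to B. *)
have [|A [Agraph Amax]] := @Zorn_bigcup _ [set A | dominated_graph (B `|` A)].
  move=> F Fgraph Ftot /=.
  have pair p q : (B `|` \bigcup_(A in F) A) p -> (B `|` \bigcup_(A in F) A) q ->
      exists2 A, dominated_graph (B `|` A) &
        A `<=` \bigcup_(A in F) A /\ ((B `|` A) p /\ (B `|` A) q).
    move=> [Bp|[A FA Ap]] [Bq|[A' FA' A'q]].
    - by exists set0; rewrite ?setU0//; split => //; apply: sub0set.
    - by exists A'; [exact: Fgraph|split; [exact: bigcup_sup|split; [left|right]]].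
    - by exists A; [exact: Fgraph|split; [exact: bigcup_sup|split; [right|left]]].
    - have [AA'|A'A] := Ftot _ _ FA FA'.
      + exists A'; [exact: Fgraph|split; [exact: bigcup_sup|split; right => //]].
        exact: AA'.
      + exists A; [exact: Fgraph|split; [exact: bigcup_sup|split; right => //]].
        exact: A'A.
  split.
  - by left; case: Bgraph.
  - move=> a p q Up Uq; have [A [_ Alin _] [AF [Ap Aq]]] := pair _ _ Up Uq.
    by have [?|/AF ?] := Alin a _ _ Ap Aq; [left|right].
  - move=> p Up; have [A [_ _ Ale] [_ [Ap _]]] := pair _ _ Up Up.
    exact: Ale.
exists (B `|` A) => //; split; first by left.
move=> A' A'graph AA' p A'p; right.
apply: contrapT => Ap; apply: (Amax A').
  split; first by move=> q Aq; apply: AA'; right.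
  by move=> A'A; exact/Ap/A'A.
rewrite /= setUidr//; apply: subset_trans AA'; exact: subsetUl.
Qed.

Theorem hahn_banach (M : set Z) (phi : Z -> R) :
    0 <= C -> linear_subspace M ->
    (forall a u v, M u -> M v -> phi (a *: u + v) = a * phi u + phi v) ->
    (forall u, M u -> phi u <= C * `|u|) ->
  exists psi : Z -> R,
    [/\ forall a u v, psi (a *: u + v) = a * psi u + psi v,
        forall u, M u -> psi u = phi u
      & forall u, `|psi u| <= C * `|u|].
Proof.
move=> C0 [M0 Mlin] philin phile.
pose graph := [set p : Z * R | M p.1 /\ p.2 = phi p.1].
have phi0 : phi 0 = 0.
  by have := philin (- 1) _ _ M0 M0; rewrite scaleN1r addNr mulN1r addNr.
have gr : dominated_graph graph.
  split => //.
  - move=> a p q [Mp pE] [Mq qE]; split => /=; first exact: Mlin.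
    by rewrite philin// pE qE.
  - by move=> p [Mp ->]; exact: phile.
have [A Agraph [grA Amax]] := dominated_graph_max gr.
have /choice[psi psiA] z : exists r, A (z, r).
  have [A' A'graph [AA' [r A'r]]] := dominated_graph_step z C0 Agraph.
  by exists r; exact: (Amax A').
have [A0 Alin Ale] := Agraph.
have lin a u v : psi (a *: u + v) = a * psi u + psi v.
  apply: (dominated_graph_fun Agraph (psiA _)).
  exact: Alin (psiA u) (psiA v).
exists psi; split => //.
- move=> u Mu; apply: (dominated_graph_fun Agraph (psiA _)).
  by apply: grA.
- move=> u; rewrite ler_norml lerNl (Ale _ (psiA u)) andbT.
  have psi0 : psi 0 = 0 by apply: (dominated_graph_fun Agraph (psiA _)).
  have := lin (- 1) u 0; rewrite !addr0 psi0 addr0 scaleN1r mulN1r => <-.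
  by have := Ale _ (psiA (- u)); rewrite /= normrN.
Qed.

End HahnBanach.

(** * The Banach space of bounded functions *)

Section BoundedFunctions.
Context {R : realType} (G : pointedType).

Definition bounded_range : {pred G -> R^o} :=
  [pred f : G -> R^o | `[< exists c : R, forall g, `|f g| <= c >]].

Lemma bounded_rangeP (f : G -> R^o) :
  reflect (exists c : R, forall g, `|f g| <= c) (f \in bounded_range).
Proof. exact: asboolP. Qed.

Record linfty :=
  Linfty { linfty_fun :> G -> R^o; _ : linfty_fun \in bounded_range }.

HB.instance Definition _ := [isSub for linfty_fun].
HB.instance Definition _ := [Choice of linfty by <:].

Lemma bounded_range_submod : submod_closed bounded_range.
Proof.
split; first by apply/bounded_rangeP; exists 0 => g; rewrite normr0.
move=> a u v /bounded_rangeP[c uc] /bounded_rangeP[d vd]; apply/bounded_rangeP.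
exists (`|a| * c + d) => g; apply: le_trans (ler_normD _ _) _.
by rewrite normrZ lerD// ler_wpM2l.
Qed.

HB.instance Definition _ := GRing.isSubmodClosed.Build _ _ bounded_range
  bounded_range_submod.
HB.instance Definition _ := [SubChoice_isSubLmodule of linfty by <:].

Implicit Types f h : linfty.

Definition sup_norm f : R := sup (range (fun g => `|f g|)).

Lemma linftyP f : exists c : R, forall g, `|f g| <= c.
Proof. by case: f => f /= /bounded_rangeP. Qed.

Lemma le_sup_norm f g : `|f g| <= sup_norm f.
Proof.
apply: ub_le_sup; last by exists g.
by have [c fc] := linftyP f; exists c => _ [x _ <-].
Qed.

Lemma sup_norm_le f c : (forall g, `|f g| <= c) -> sup_norm f <= c.
Proof.
move=> fc; apply: ge_sup; first by exists `|f point|, point.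
by move=> _ [x _ <-].
Qed.

Lemma sup_normD f h : sup_norm (f + h) <= sup_norm f + sup_norm h.
Proof.
apply: sup_norm_le => g; apply: le_trans (ler_normD _ _) _.
by rewrite lerD// le_sup_norm.
Qed.

Lemma sup_normZ (a : R) f : sup_norm (a *: f) = `|a| * sup_norm f.
Proof.
have le b h : sup_norm (b *: h) <= `|b| * sup_norm h.
  by apply: sup_norm_le => g; rewrite normrZ ler_wpM2l// le_sup_norm.
apply/eqP; rewrite eq_le le/=.
have [->|a0] := eqVneq a 0.
  by rewrite normr0 mul0r (le_trans _ (le_sup_norm _ point)).
have := le a^-1 (a *: f); rewrite scalerA mulVf// scale1r normfV.
by rewrite ler_pdivlMl ?normr_gt0.
Qed.

Lemma sup_norm0_eq0 f : sup_norm f = 0 -> f = 0.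
Proof.
move=> f0; apply/val_inj/funext => g; apply/eqP.
by rewrite -normr_le0 -f0 le_sup_norm.
Qed.

HB.instance Definition _ := Lmodule_isNormed.Build R linfty
  sup_normD sup_normZ sup_norm0_eq0.

Lemma linfty_le_norm f g : `|f g| <= `|f|.
Proof. exact: le_sup_norm. Qed.

Lemma linfty_norm_le f c : (forall g, `|f g| <= c) -> `|f| <= c.
Proof. exact: sup_norm_le. Qed.

(** A Cauchy filter of functions converges at each point by completeness of R;
    the Cauchy estimate is uniform in the point, and passes to the limit. *)
Lemma linfty_complete (F : set_system linfty) :
  ProperFilter F -> cauchy F -> cvg F.
Proof.
move=> FF Fc.
have near_cauchy (e : R) : 0 < e -> \forall f \near F, \forall h \near F, `|f - h| < e.
  by move: Fc => /cauchy_ballP Fc e0; apply: nearP_dep; exact: Fc.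
have pt g : cvg ((fun f => f g : R^o) @ F).
  apply/cauchy_cvgP/cauchy_exP => e e0.
  have /filter_ex[f fF] := near_cauchy e e0.
  exists (f g); rewrite /nbhs/=; near=> h.
  by apply: le_lt_trans (linfty_le_norm (f - h) g) _; near: h.
pose l g : R^o := lim ((fun f => f g : R^o) @ F).
pose close_to e (f : linfty) := forall g, `|l g - f g| <= e.
  have close (e : R) : 0 < e -> \forall f \near F, close_to e f.
  move=> e0; near=> f => g.
  have : (fun h => `|h g - f g|) @ F --> `|l g - f g|.
    by apply: cvg_norm; apply: cvgB; [exact: pt|exact: cvg_cst].
  apply: (@closed_cvg _ _ _ _ _ (fun x : R => x <= e)); first exact: closed_le.
  near=> h; rewrite distrC; apply: le_trans (linfty_le_norm (f - h) g) _.
  apply: ltW.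
  by near: h; near: f; exact: near_cauchy.
have lb : l \in bounded_range.
  apply/bounded_rangeP; have /filter_ex[f /= fl] := close 1 ltr01.
  exists (1 + `|f|) => g; rewrite -[l g](subrK (f g)).
  by apply: le_trans (ler_normD _ _) _; rewrite lerD// linfty_le_norm.
apply/cvg_ex; exists (Linfty lb); apply/cvgrPdist_le => e e0.
near=> f; apply: linfty_norm_le => g /=.
by move: g; near: f; exact: close.
Unshelve. all: by end_near. Qed.

HB.instance Definition _ := Uniform_isComplete.Build linfty linfty_complete.

End BoundedFunctions.

(** * Linear spans and operators on subspaces *)

Section Spans.
Context {R : realType} {Y : normedModType R}.

Lemma linear_subspace_span (S : set Y) : linear_subspace (linear_span S).
Proof.
split; first by exists 0%N, (fun _ => 0), (fun _ => 0); rewrite big_ord0; split => // -[].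
move=> a _ _ [m [b [s [Ss ->]]]] [n [c [t [St ->]]]].
exists (m + n)%N,
  (fun k => match fintype.split k with inl i => a * b i | inr j => c j end),
  (fun k => match fintype.split k with inl i => s i | inr j => t j end); split.
  by move=> k; case: (fintype.split k).
rewrite big_split_ord/= scaler_sumr; congr (_ + _); apply: eq_bigr => k _.
  by rewrite (unsplitK (inl k)) scalerA.
by rewrite (unsplitK (inr k)).
Qed.

Lemma linear_span_sub (S : set Y) : S `<=` linear_span S.
Proof.
move=> y Sy; exists 1%N, (fun _ => 1), (fun _ => y).
by rewrite big_ord1 scale1r.
Qed.

Lemma linear_subspaceZ (M : set Y) a u : linear_subspace M -> M u -> M (a *: u).
Proof. by move=> [M0 Ml] Mu; rewrite -[_ *: _]addr0; exact: Ml. Qed.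

Lemma linear_subspaceB (M : set Y) u v :
  linear_subspace M -> M u -> M v -> M (u - v).
Proof. by move=> [M0 Ml] Mu Mv; rewrite addrC -scaleN1r; exact: Ml. Qed.

End Spans.

Section LinearOn.
Context {R : realType} {Y X : normedModType R} {M : set Y} {T : Y -> X}.
Hypotheses (Msub : linear_subspace M)
  (Tlin : forall a u v, M u -> M v -> T (a *: u + v) = a *: T u + T v).

Lemma linear_on0 : T 0 = 0.
Proof.
have [M0 _] := Msub.
by have := Tlin (- 1) M0 M0; rewrite scaleN1r addNr scaleN1r addNr.
Qed.

Lemma linear_onZ a u : M u -> T (a *: u) = a *: T u.
Proof.
have [M0 _] := Msub.
by move=> Mu; have := Tlin a Mu M0; rewrite linear_on0 !addr0.
Qed.

Lemma linear_onB u v : M u -> M v -> T (u - v) = T u - T v.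
Proof. by move=> Mu Mv; rewrite addrC -scaleN1r Tlin// scaleN1r addrC. Qed.

End LinearOn.

(** * Local projections from left stability *)

Section LocalProjections.
Context {R : realType}.

Lemma norm_normalize (Y : normedModType R) (y : Y) : `| `|y|^-1 *: y| <= 1.
Proof.
have [->|y0] := eqVneq y 0; first by rewrite scaler0 normr0.
by rewrite normfZV.
Qed.

(** The points where an isometry gets bumped: n distinct nonzero points of a
    bounded set. *)
Definition multiples (X : normedModType R) (x0 : X) (n : nat) : seq X :=
  mkseq (fun k => k.+1%:R *: x0) n.

Lemma multiples_uniq (X : normedModType R) (x0 : X) n :
  x0 != 0 -> uniq (multiples x0 n).
Proof.
move=> x00; apply: mkseq_uniq => j k /eqP.
rewrite -subr_eq0 -scalerBl scaler_eq0 (negPf x00) orbF subr_eq0 eqr_nat.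
by rewrite eqSS => /eqP.
Qed.

Lemma multiples_norm (X : normedModType R) (x0 x : X) n :
  x \in multiples x0 n -> `|x| <= n%:R * `|x0|.
Proof.
move=> /mapP[k]; rewrite mem_iota add0n => /andP[_ kn] ->.
by rewrite normrZ ger0_norm// ler_wpM2r// ler_nat.
Qed.

Lemma zero_notin_multiples (X : normedModType R) (x0 : X) n :
  x0 != 0 -> 0 \notin multiples x0 n.
Proof.
move=> x00; apply/negP => /mapP[k _ /esym/eqP].
by rewrite scaler_eq0 (negPf x00) orbF pnatr_eq0.
Qed.

(** Large multiples of a nonzero x leave the bounded set of bump points; for
    x = 0 it is enough that 0 is not one of them. *)
Lemma far_multiple (X : normedModType R) (x0 x : X) (n N : nat) : x0 != 0 ->
  exists2 m, (N < m)%N & m%:R *: x \notin multiples x0 n.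
Proof.
move=> x00; have [->|x_neq0] := eqVneq x 0.
  by exists N.+1 => //; rewrite scaler0 zero_notin_multiples.
pose r : R := n%:R * `|x0| / `|x|.
have r0 : 0 <= r by rewrite divr_ge0// mulr_ge0.
exists (Num.bound r + N.+1)%N; first by rewrite addnS ltnS leq_addl.
apply/negP => /multiples_norm; rewrite leNgt normrZ ger0_norm//.
rewrite -ltr_pdivrMr ?normr_gt0// -/r => /negP; apply.
by rewrite natrD ltr_pwDr// ltW// archi_boundP.
Qed.

Context {X Y : completeNormedModType R} (i : X -> Y).
Hypotheses (ilin : forall a u v, i (a *: u + v) = a *: i u + i v)
  (iiso : forall x, `|i x| = `|x|).

Let i0 : i 0 = 0.
Proof. by apply/eqP; rewrite -normr_eq0 iiso normr0. Qed.
Let iZ a x : i (a *: x) = a *: i x.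
Proof. by rewrite -[a *: x]addr0 ilin i0 addr0. Qed.
Let iB x y : i (x - y) = i x - i y.
Proof. by rewrite addrC -scaleN1r ilin scaleN1r addrC. Qed.

(** At the k-th bump point the normalized k-th entry of s is added to i; away
    from the bump points the index is out of range and the default 0 is added. *)
Definition bumped (x0 : X) (s : seq Y) (x : X) : Y :=
  i x + [seq `|y|^-1 *: y | y <- s]`_(index x (multiples x0 (size s))).

Lemma bumped_out (x0 : X) (s : seq Y) x :
  x \notin multiples x0 (size s) -> bumped x0 s x = i x.
Proof.
move=> x_out; rewrite /bumped nth_default ?addr0//.
by rewrite memNindex// size_mkseq size_map.
Qed.

Lemma bumped_in (x0 : X) (s : seq Y) y : x0 != 0 -> y \in s ->
  exists x, bumped x0 s x = i x + `|y|^-1 *: y.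
Proof.
move=> x00 ys; have k_lt : (index y s < size s)%N by rewrite index_mem.
exists ((index y s).+1%:R *: x0).
rewrite /bumped -(nth_mkseq 0 (fun k => k.+1%:R *: x0) k_lt).
rewrite index_uniq ?size_mkseq ?multiples_uniq//.
by congr (_ + _); rewrite (nth_map 0)// nth_index.
Qed.

(** The bumps have norm at most 1, so differences of values of f and of i differ
    by at most 2. *)
Lemma bumped_isometry (x0 : X) (s : seq Y) : x0 != 0 ->
  standard_eps_isometry 2 (bumped x0 s).
Proof.
move=> x00; split; first by rewrite bumped_out ?zero_notin_multiples.
move=> x y; rewrite -[`|x - y|]iiso iB; apply: le_trans (ler_dist_dist _ _) _.
have bump_le k : `|[seq `|y|^-1 *: y | y <- s]`_k| <= 1.
  have [ks|ks] := ltnP k (size s); last by rewrite nth_default ?size_map// normr0.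
  by rewrite (nth_map 0)// norm_normalize.
rewrite /bumped [- (i y + _)]opprD addrACA [X in `|X|]addrC addKr.
by apply: le_trans (ler_normB _ _) _; rewrite (_ : 2 = 1 + 1)// lerD.
Qed.

(** The constant C precedes the finite list s: it is 2 gamma, for the gamma that
    stability attaches to Y.  The operator Q is the left inverse that stability
    gives for i bumped in the directions of s. *)
Lemma stable_local_projections : universally_left_stable X ->
  exists2 C : R, 0 <= C & forall s : seq Y, exists Q : Y -> X,
    [/\ forall x, Q (i x) = x,
        forall y, y \in s -> `|Q y| <= C * `|y|
      & forall a u v, u \in s -> v \in s -> Q (a *: u + v) = a *: Q u + Q v].
Proof.
move=> /(_ Y)[c c0 stable]; exists (c * 2); first by rewrite mulr_ge0// ltW.
(* Bump points exist only in a nonzero X. *)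
move=> s; have [[x0 x00]|X0] := pselect (exists x0 : X, x0 != 0); last first.
  have {}X0 (x : X) : x = 0 by apply/eqP/negPn/negP => x0; apply: X0; exists x.
  exists (fun _ => 0); split => [x|y _|a u v _ _]; last 2 first.
  - by rewrite normr0 !mulr_ge0// ltW.
  - by rewrite scaler0 addr0.
  - by rewrite [RHS]X0.
set f := bumped x0 s.
have [T [Tlin' _] Tf] := stable 2 f (ler0n _ _) (bumped_isometry s x00).
have Tfx x : `|T (f x) - x| <= c * 2 := Tf x.
pose M := linear_span (range f).
have Msub : linear_subspace M by exact: linear_subspace_span.
have Tlin a u v : M u -> M v -> T (a *: u + v) = a *: T u + T v.
  by move=> Mu Mv; apply: Tlin'; exact: subset_closure.
have Mf x : M (f x) by apply: linear_span_sub; exists x.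
have Mi x : M (i x).
  have [m m0 mx] := far_multiple x (size s) 0 x00.
  have -> : i x = m%:R^-1 *: f (m%:R *: x).
    by rewrite /f bumped_out// iZ scalerA mulVf ?scale1r// pnatr_eq0 -lt0n.
  exact: linear_subspaceZ.
have Ti x : T (i x) = x.
  (* m |T (i x) - x| <= c * 2 for arbitrarily large m *)
  apply/eqP; rewrite -subr_eq0 -normr_le0.
  apply/ler_addgt0Pr => e e0; rewrite add0r.
  have [m m_gt mx] := far_multiple x (size s) (Num.bound (c * 2 / e)) x00.
  have m0 : 0 < m%:R :> R by rewrite ltr0n (leq_ltn_trans _ m_gt).
  have := Tfx (m%:R *: x).
  rewrite /f bumped_out// iZ (linear_onZ Msub Tlin)// -scalerBr normrZ ger0_norm//.
  rewrite -ler_pdivlMl// => /le_trans; apply.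
  rewrite ler_pdivrMl// -ler_pdivrMr//; apply: ltW.
  apply: (lt_trans (archi_boundP _)); last by rewrite ltr_nat.
  by rewrite divr_ge0 ?mulr_ge0// ltW.
have Mdir y : y \in s -> M (`|y|^-1 *: y) /\ `|T (`|y|^-1 *: y)| <= c * 2.
  move=> ys; have [x fx] := bumped_in x00 ys.
  have -> : `|y|^-1 *: y = f x - i x by rewrite /f fx addrC addKr.
  by rewrite (linear_onB Tlin)// Ti; split => //; exact: linear_subspaceB.
have sE (y : Y) : y = `|y| *: (`|y|^-1 *: y).
  have [->|y0] := eqVneq y 0; first by rewrite !scaler0.
  by rewrite scalerA divff ?scale1r// normr_eq0.
have Ms y : y \in s -> M y.
  by move=> ys; rewrite (sE y); apply: linear_subspaceZ => //; have [] := Mdir y ys.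
exists T; split => // [y ys|a u v us vs]; last by apply: Tlin; exact: Ms.
have [Mu Tu] := Mdir y ys.
by rewrite {1}(sE y) (linear_onZ Msub Tlin)// normrZ normr_id mulrC ler_wpM2r.
Qed.

End LocalProjections.

(** * Weak* limits of local projections *)

Lemma ultra_bounded_cvg (R : realType) (T : Type) (U : set_system T)
    (h : T -> R^o) (c : R) :
  UltraFilter U -> (\forall t \near U, `|h t| <= c) -> cvg (h t @[t --> U]).
Proof.
move=> UU hc.
have hU : UltraFilter (h @ U).
  split; first exact: fmap_proper_filter.
  move=> G GP hUG; apply/seteqP; split => // A GA.
  have [//|UA] := in_ultra_setVsetC (h @^-1` A) UU.
  have /filter_ex[r []//] : G (A `&` ~` A) by apply: filterI => //; exact: hUG.
have := @segment_compact R (- c) c; rewrite compact_ultra => /(_ _ hU) [].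
  by move: hc; apply: filterS => t /=; rewrite in_itv/= ler_norml.
by move=> p [_ hp]; apply/cvg_ex; exists p.
Qed.

Section Duality.
Context {R : realType} {X W : normedModType R} (J : X -> W -> R^o).
Hypotheses (Jbounded : forall x, bounded_linear_on setT (J x))
  (Jlin : forall (a : R) (x y : X) (w : W), J (a *: x + y) w = a * J x w + J y w)
  (Jnorm : forall x, dual_norm (J x) = `|x|).

Lemma pairing_le_norm_ball x w : `|w| <= 1 -> `|J x w| <= `|x|.
Proof.
move=> w1; rewrite -Jnorm; apply: ub_le_sup; last by exists w.
have [_ [c Jc]] := Jbounded x; exists `|c| => _ [v /= v1 <-].
apply: le_trans (Jc v I) _; rewrite -[`|c|]mulr1.
by apply: (le_trans (ler_norm _)); rewrite normrM normr_id ler_wpM2l.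
Qed.

Lemma pairing_linear x a u v : J x (a *: u + v) = a * J x u + J x v.
Proof. by have [Jl _] := Jbounded x; rewrite Jl. Qed.

Lemma pairing0r x : J x 0 = 0.
Proof.
by have := pairing_linear x (- 1) 0 0; rewrite scaleN1r addNr mulN1r addNr.
Qed.

Lemma pairing_le x w : `|J x w| <= `|x| * `|w|.
Proof.
have [->|w0] := eqVneq w 0; first by rewrite pairing0r !normr0 mulr0.
have := @pairing_le_norm_ball x (`|w|^-1 *: w).
rewrite normfZV// => /(_ (lexx _)).
rewrite -[_ *: w]addr0 pairing_linear pairing0r addr0 normrM normfV normr_id.
by rewrite ler_pdivrMl ?normr_gt0// mulrC.
Qed.

Lemma norm_le_pairing x (c : R) :
  (forall w, `|w| <= 1 -> `|J x w| <= c) -> `|x| <= c.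
Proof.
move=> Jc; rewrite -Jnorm; apply: ge_sup.
  by exists `|J x 0|, 0 => //=; rewrite normr0.
by move=> _ [w w1 <-]; exact: Jc.
Qed.

Lemma pairing_inj x y : (forall w, J x w = J y w) -> x = y.
Proof.
move=> Jxy; apply/eqP; rewrite -subr_eq0 -normr_le0; apply: norm_le_pairing => w _.
by rewrite addrC -scaleN1r Jlin Jxy mulN1r addNr normr0.
Qed.

Hypothesis Jsurj : forall phi : W -> R^o, bounded_linear_on setT phi ->
  exists x, forall w, J x w = phi w.

(** For y in Y and w in W the numbers J (Q s y) w are bounded by C |y| |w| once
    s contains y, so they converge along an ultrafilter on the finite lists s
    that contains, for each y, the set of lists in which y occurs.  The
    limit is bounded linear in w, hence is J (P y) w for some P y.  An identity
    for P involves finitely many vectors of Y, and holds for Q s as soon as s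
    contains them. *)
Lemma dual_projection_of_local (Y : normedModType R) (i : X -> Y) (C : R) : 0 <= C ->
    (forall s : seq Y, exists Q : Y -> X,
      [/\ forall x, Q (i x) = x,
        forall y, y \in s -> `|Q y| <= C * `|y|
      & forall a u v, u \in s -> v \in s -> Q (a *: u + v) = a *: Q u + Q v]) ->
  exists2 P : Y -> X, bounded_linear_on setT P & forall x, P (i x) = x.
Proof.
move=> C0 /choice[Q Qspec].
have Qi s x : Q s (i x) = x by have [] := Qspec s.
have Qle s y : y \in s -> `|Q s y| <= C * `|y| by have [_ Qs _] := Qspec s; exact: Qs.
have Qlin s a u v : u \in s -> v \in s -> Q s (a *: u + v) = a *: Q s u + Q s v.
  by have [_ _ Qs] := Qspec s; exact: Qs.
pose F := [set A : set (seq Y) |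
  exists s0 : seq Y, forall s, {subset s0 <= s} -> A s].
have FF : ProperFilter F.
  split; first by move=> [s0 /(_ s0)]; exact.
  split.
  - by exists [::].
  - move=> A B [s As] [t Bt]; exists (s ++ t) => r str; split.
    + by apply: As => y ys; apply: str; rewrite mem_cat ys.
    + by apply: Bt => y yt; apply: str; rewrite mem_cat yt orbT.
  - by move=> A B AB [s As]; exists s => t st; exact/AB/As.
have [U [UU FU]] := ultraFilterLemma FF.
have U_in y : \forall s \near U, y \in s.
  by apply: FU; exists [:: y] => s; apply; rewrite mem_head.
pose phi y w : R^o := lim (J (Q s y) w @[s --> U]).
have Jle y w : \forall s \near U, `|J (Q s y) w| <= C * `|y| * `|w|.
  apply: filterS (U_in y) => s ys; apply: le_trans (pairing_le _ _) _.
  by rewrite ler_wpM2r// Qle.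
have phiP y w : J (Q s y) w @[s --> U] --> phi y w.
  exact: (ultra_bounded_cvg UU (Jle y w)).
have phi_eq y w r : J (Q s y) w @[s --> U] --> (r : R^o) -> phi y w = r.
  by move=> cr; apply: cvg_lim cr; exact: Rhausdorff.
have phi_le y w : `|phi y w| <= C * `|y| * `|w|.
  apply: (@closed_cvg _ _ U _ (fun s => `|J (Q s y) w| : R)
    [set r | r <= C * `|y| * `|w|]).
  - exact: closed_le.
  - exact: Jle.
  - exact: cvg_norm (phiP y w).
have /choice[P JP] y : exists x, forall w, J x w = phi y w.
  apply: Jsurj; split; last by exists (C * `|y|) => w _; exact: phi_le.
  move=> a u v _ _; apply: phi_eq.
  under eq_fun do rewrite pairing_linear.
  by apply: cvgD; [apply: cvgZr; exact: phiP|exact: phiP].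
exists P.
  split; last first.
    exists C => y _; apply: norm_le_pairing => w w1; rewrite JP.
    by apply: (le_trans (phi_le _ _)); rewrite -[leRHS]mulr1 ler_wpM2l// mulr_ge0.
  move=> a u v _ _; apply: pairing_inj => w; rewrite Jlin !JP; apply: phi_eq.
  have lim_uv :
      a * J (Q s u) w + J (Q s v) w @[s --> U] --> a * phi u w + phi v w.
    by apply: cvgD; [apply: cvgZr; exact: phiP|exact: phiP].
  apply: cvg_trans lim_uv; apply: near_eq_cvg.
  by near=> s; rewrite Qlin ?Jlin//; near: s; exact: U_in.
move=> x; apply: pairing_inj => w; rewrite JP; apply: phi_eq.
under eq_fun do rewrite Qi; exact: cvg_cst.
Unshelve. all: by end_near. Qed.

End Duality.

(** * Embedding a dual space into bounded functions *)

Section DualEmbedding.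
Context {R : realType} {X W : normedModType R} (J : X -> W -> R^o).
Hypotheses (Jbounded : forall x, bounded_linear_on setT (J x))
  (Jlin : forall (a : R) (x y : X) (w : W), J (a *: x + y) w = a * J x w + J y w)
  (Jnorm : forall x, dual_norm (J x) = `|x|).

(** A functional on W is unbounded unless it is 0; cutting it off outside the
    unit ball makes its supremum norm the dual norm, and keeps linearity in x. *)
Definition ball_pairing (x : X) (w : W) : R^o := if `|w| <= 1 then J x w else 0.

Lemma ball_pairing_linear a x y w :
  ball_pairing (a *: x + y) w = a * ball_pairing x w + ball_pairing y w.
Proof. by rewrite /ball_pairing; case: ifP => _; rewrite ?Jlin// mulr0 addr0. Qed.

Lemma ball_pairing_le x w : `|ball_pairing x w| <= `|x|.
Proof.
rewrite /ball_pairing; case: ifP => [w1|_]; last by rewrite normr0.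
exact: (pairing_le_norm_ball Jbounded).
Qed.

Lemma ball_pairing_bounded x : ball_pairing x \in @bounded_range R W.
Proof. by apply/bounded_rangeP; exists `|x|; exact: ball_pairing_le. Qed.

Definition dual_embedding (x : X) : linfty W := Linfty (ball_pairing_bounded x).

Lemma dual_embedding_linear a x y :
  dual_embedding (a *: x + y) = a *: dual_embedding x + dual_embedding y.
Proof. by apply/val_inj/funext => w; exact: ball_pairing_linear. Qed.

Lemma dual_embedding_norm x : `|dual_embedding x| = `|x|.
Proof.
apply/eqP; rewrite eq_le; apply/andP; split.
  by apply: linfty_norm_le; exact: ball_pairing_le.
apply: (norm_le_pairing Jnorm) => w w1.
by have := linfty_le_norm (dual_embedding x) w; rewrite /= /ball_pairing w1.
Qed.

(** If |T u| <= |c| |u|, every extended coordinate is bounded by |c| |u|,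
    whatever w is, so together the coordinates form a bounded function. *)
Lemma dual_embedding_extension (Z : normedModType R) (M : set Z) (T : Z -> X) :
  linear_subspace M -> bounded_linear_on M T ->
  exists2 T' : Z -> linfty W, bounded_linear_on setT T' &
    forall u, M u -> T' u = dual_embedding (T u).
Proof.
move=> Msub [Tlin [c Tc]].
have Tle u : M u -> `|T u| <= `|c| * `|u|.
  by move=> Mu; apply: le_trans (Tc u Mu) _; rewrite ler_wpM2r// ler_norm.
have /choice[psi psiP] w : exists psi : Z -> R,
    [/\ forall a u v, psi (a *: u + v) = a * psi u + psi v,
        forall u, M u -> psi u = ball_pairing (T u) w
      & forall u, `|psi u| <= `|c| * `|u|].
  apply: hahn_banach => // [a u v Mu Mv|u Mu].
    by rewrite Tlin// ball_pairing_linear.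
  apply: le_trans (Tle u Mu); apply: (le_trans (ler_norm _)).
  exact: ball_pairing_le.
have psi_lin w a u v : psi w (a *: u + v) = a * psi w u + psi w v.
  by have [+ _ _] := psiP w.
have psi_ext w u : M u -> psi w u = ball_pairing (T u) w.
  by have [_ + _] := psiP w; exact.
have psi_le w u : `|psi w u| <= `|c| * `|u| by have [_ _ +] := psiP w; exact.
have bounded u : (fun w => psi w u : R^o) \in @bounded_range R W.
  by apply/bounded_rangeP; exists (`|c| * `|u|) => w; exact: psi_le.
exists (fun u => Linfty (bounded u)).
  split; last by exists `|c| => u _; apply: linfty_norm_le => w; exact: psi_le.
  by move=> a u v _ _; apply/val_inj/funext => w; exact: psi_lin.
by move=> u Mu; apply/val_inj/funext => w; exact: psi_ext.
Qed.

End DualEmbedding.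

(** * Dual universally left-stable spaces are injective *)

Theorem corollary2p8 (R : realType) (X W : completeNormedModType R)
  (X_dual : is_dual_of X W) (X_stable : universally_left_stable X) :
  injective_space X.
Proof.
have [J [Jbounded Jlin Jnorm Jsurj]] := X_dual.
move=> Z M T Msub _ Tbounded.
have ilin := dual_embedding_linear Jbounded Jlin Jnorm.
have inorm := dual_embedding_norm Jbounded Jnorm.
have [C C0 local] := stable_local_projections ilin inorm X_stable.
have [P [Plin [c Pc]] Pi] :=
  dual_projection_of_local Jbounded Jlin Jnorm Jsurj C0 local.
have [T' [T'lin [d T'd]] T'E] :=
  dual_embedding_extension Jbounded Jlin Jnorm Msub Tbounded.
exists (P \o T'); last by move=> z Mz /=; rewrite T'E// Pi.
split; first by move=> a u v _ _ /=; rewrite T'lin// Plin.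
exists (`|c| * d) => u _ /=; apply: (le_trans (Pc _ I)).
rewrite -mulrA; apply: (le_trans (ler_norm _)).
by rewrite normrM normr_id ler_wpM2l// T'd.
Qed.
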